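(* Let $G$ be a finite group with centre $Z$ such that $G/Z\cong D_{2n}$, the dihedral group of order $2n$. Then the commuting conjugacy class graph $\Gamma(G)$ is not CN-hyperenergetic. In particular, if $G\cong D_6$ (the dihedral group of order $6$) then $\Gamma(G)$ is CN-borderenergetic.
   Context: For a finite non-abelian group $G$, the commuting conjugacy class graph $\Gamma(G)$ is the simple undirected graph whose vertices are the conjugacy classes of the non-central elements of $G$; two distinct vertices $a^G$ and $b^G$ are adjacent if there exist $a'\in a^G$, $b'\in b^G$ with $a'b'=b'a'$. For a finite simple graph $\mathcal{G}$ with vertices $v_1,\dots,v_N$, the common neighbourhood matrix $CN(\mathcal{G})$ is the $N\times N$ matrix whose $(i,j)$ entry is, for $i\ne j$, the number of vertices other than $v_i,v_j$ adjacent to both $v_i$ and $v_j$, and is $0$ for $i=j$. The CN-energy $E_{CN}(\mathcal{G})$ is the sum of the absolute values of the eigenvalues of $CN(\mathcal{G})$, counted with multiplicity. With $K_N$ the complete graph on $N=|V(\mathcal{G})|$ vertices, $\mathcal{G}$ is CN-hyperenergetic if $E_{CN}(\mathcal{G})>E_{CN}(K_N)$, and CN-borderenergetic if $E_{CN}(\mathcal{G})=E_{CN}(K_N)$. *)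

(* Defs.v *)
From HB Require Import structures.
From mathcomp Require Import all_boot all_order all_fingroup all_algebra.
From mathcomp Require Import all_solvable all_field.

Set Implicit Arguments.
Unset Strict Implicit.
Unset Printing Implicit Defensive.

Import Order.TTheory GRing.Theory Num.Theory.

Local Open Scope ring_scope.

Record sgraph := SGraph {
  svertex :> finType;
  sadj : rel svertex;
  sadj_sym : symmetric sadj;
  sadj_irrefl : irreflexive sadj
}.

Lemma complete_sym N : symmetric (fun i j : 'I_N => i != j).
Proof. by move=> i j; rewrite eq_sym. Qed.

Lemma complete_irrefl N : irreflexive (fun i j : 'I_N => i != j).
Proof. by move=> i; rewrite eqxx. Qed.

Definition complete_graph (N : nat) : sgraph :=
  SGraph (@complete_sym N) (@complete_irrefl N).

Definition common_neighbours (Gr : sgraph) (u v : Gr) : {set Gr} :=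
  [set w | [&& w != u, w != v, sadj u w & sadj v w]].

Definition CN (Gr : sgraph) : 'M[algC]_#|Gr| :=
  \matrix_(i, j)
    if i == j then 0 else #|common_neighbours (enum_val i) (enum_val j)|%:R.

(* The eigenvalues of A, repeated according to their algebraic multiplicity. *)
Definition spectrum (n : nat) (A : 'M[algC]_n) : seq algC :=
  sval (closed_field_poly_normal (char_poly A)).

Lemma spectrumP (n : nat) (A : 'M[algC]_n) :
  char_poly A = \prod_(z <- spectrum A) ('X - z%:P).
Proof.
rewrite /spectrum; case: closed_field_poly_normal => r /= Er.
by rewrite {1}Er (monicP (char_poly_monic A)) scale1r.
Qed.

Definition CN_energy (Gr : sgraph) : algC := \sum_(z <- spectrum (CN Gr)) `|z|.

Definition CN_hyperenergetic (Gr : sgraph) : Prop :=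
  CN_energy Gr > CN_energy (complete_graph #|Gr|).

Definition CN_borderenergetic (Gr : sgraph) : Prop :=
  CN_energy Gr = CN_energy (complete_graph #|Gr|).

Section CommutingConjugacyClassGraph.

Local Open Scope group_scope.

Variables (gT : finGroupType) (G : {group gT}).

Definition noncentral_classes : {set {set gT}} :=
  [set x ^: G | x in G :\: 'Z(G)].

Definition ccc_vertex : finType := {C : {set gT} | C \in noncentral_classes}.

Definition ccc_adj : rel ccc_vertex := fun A B =>
  (A != B) &&
  [exists a in val A, exists b in val B, (a * b == b * a :> gT)].

Lemma ccc_adj_sym : symmetric ccc_adj.
Proof.
suff sub A B : ccc_adj A B -> ccc_adj B A by move=> A B; apply/idP/idP; apply: sub.
case/andP=> nAB /exists_inP[a Aa /exists_inP[b Bb /eqP ab]].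
rewrite /ccc_adj eq_sym nAB; apply/exists_inP; exists b => //.
by apply/exists_inP; exists a => //; rewrite ab.
Qed.

Lemma ccc_adj_irrefl : irreflexive ccc_adj.
Proof. by move=> A; rewrite /ccc_adj eqxx. Qed.

Definition ccc_graph : sgraph := SGraph ccc_adj_sym ccc_adj_irrefl.

End CommutingConjugacyClassGraph.

(* Main.v *)
Require Import Defs.
From HB Require Import structures.
From mathcomp Require Import all_boot all_order all_fingroup all_algebra.
From mathcomp Require Import all_solvable all_field.

Set Implicit Arguments.
Unset Strict Implicit.
Unset Printing Implicit Defensive.

Import Order.TTheory GRing.Theory Num.Theory.
Local Open Scope ring_scope.

(** The first claim is an instance of a fact about arbitrary finite graphs:
    none of them is CN-hyperenergetic ([not_CN_hyperenergetic]).

    Let [Gr] have [N] vertices, adjacency matrix [A] and diagonal degree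
    matrix [D].  Since [A] is symmetric, [CN Gr = A *m A^T - D].  Three facts
    about the eigenvalues of [CN Gr] follow.
    - They are real and at least [- (N - 1)], because [A *m A^T] is positive
      semidefinite and all degrees are at most [N - 1]
      ([CN_eigenvalue_ge]).
    - They are at most [(N - 1) * (N - 2)] in absolute value, because this
      bounds the row sums: the diagonal of [CN Gr] is null and two vertices
      have at most [N - 2] common neighbours ([CN_eigenvalue_norm_le]).
    - They add up to [0], the trace of [CN Gr].
    By the last fact the energy is twice the sum of the positive eigenvalues,
    and also twice the sum of the absolute values of the negative ones.  If at
    most one eigenvalue is positive, the second fact bounds the energy by
    [2 * (N - 1) * (N - 2)].  Otherwise at most [N - 2] eigenvalues are
    negative, and the first fact gives the same bound ([CN_energy_le]).

    The complete graph reaches this bound: the all-one vector is an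
    eigenvector for [(N - 1) * (N - 2)], and the other eigenvalues sum to the
    opposite value ([CN_energy_complete_ge]).

    For the dihedral group of order 6, counting elements shows that there are
    at most two non-central classes ([card_noncentral_classes]).  A graph with
    at most two vertices has energy [0] by the bound above, and so does the
    complete graph on as many vertices. *)

(** * Sums of absolute values of numbers adding up to zero *)

Lemma ler_sum_count (R : numDomainType) (s : seq R) (P : pred R) (F : R -> R)
    (c : R) :
  {in s, forall x, P x -> F x <= c} ->
  \sum_(x <- s | P x) F x <= c *+ count P s.
Proof.
move=> leFc; apply: (@le_trans _ _ (\sum_(x <- s | P x) c)).
  rewrite big_seq_cond [leRHS]big_seq_cond.
  by apply: ler_sum => x /andP[sx Px]; apply: leFc.
by rewrite big_const_seq iter_addr_0.
Qed.

(** The positive and the negative terms balance each other, so that either kind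
    contributes half of the sum of absolute values. *)
Lemma sum_norm_zero_sum (R : numDomainType) (s : seq R) :
    {in s, forall x, x \is Num.real} -> \sum_(x <- s) x = 0 ->
  \sum_(x <- s) `|x| = (\sum_(x <- s | 0 < x) x) *+ 2
  /\ \sum_(x <- s) `|x| = (\sum_(x <- s | x < 0) - x) *+ 2.
Proof.
move=> sR s0.
have pos : {in s, forall x, `|x| = (if 0 < x then x else 0) *+ 2 - x}.
  move=> x /sR/real_ltgt0P[x0|x0|->]; rewrite ?mul0rn ?sub0r ?oppr0 //.
  by rewrite mulr2n addrK.
have neg : {in s, forall x, `|x| = (if x < 0 then - x else 0) *+ 2 + x}.
  move=> x /sR/real_ltgt0P[x0|x0|->]; rewrite ?mul0rn ?add0r //.
  by rewrite mulr2n addrNK.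
split; first by rewrite (eq_big_seq _ pos) sumrB s0 subr0 sumrMnl -big_mkcond.
by rewrite (eq_big_seq _ neg) big_split /= s0 addr0 sumrMnl -big_mkcond.
Qed.

(** With at most one positive term, compute the sum from the positive terms;
    with two or more, at most [b] terms are negative, each of absolute value at
    most [a]. *)
Lemma sum_norm_zero_sum_ub (R : numDomainType) (s : seq R) (a b : nat) :
    \sum_(x <- s) x = 0 -> (size s <= b.+2)%N ->
    {in s, forall x, - a%:R <= x <= (a * b)%:R} ->
  \sum_(x <- s) `|x| <= (a * b)%:R *+ 2.
Proof.
move=> s0 size_s s_ab.
have sR: {in s, forall x, x \is Num.real}.
  by move=> x /s_ab/andP[/ler_real <- _]; rewrite realN realn.
have [Epos Eneg] := sum_norm_zero_sum sR s0.
have [pos_le1 | pos_ge2] := leqP (count (> 0) s) 1.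
  rewrite Epos lerMn2r /=.
  have /le_trans-> // : \sum_(x <- s | 0 < x) x <= (a * b)%:R *+ count (> 0) s.
    by apply: ler_sum_count => x /s_ab/andP[].
  by rewrite -mulrnA ler_nat -[leqRHS]muln1 leq_mul2l pos_le1 orbT.
rewrite Eneg lerMn2r /=.
have /le_trans-> // : \sum_(x <- s | x < 0) - x <= a%:R *+ count (< 0) s.
  by apply: ler_sum_count => x /s_ab/andP[ax _] _; rewrite lerNl.
rewrite -mulrnA ler_nat leq_mul2l; apply/orP; right.
rewrite -(leq_add2l 2) (leq_trans _ size_s) //.
apply: (leq_trans (leq_add pos_ge2 (leqnn _))).
rewrite -(count_predC (> 0) s) leq_add2l sub_count // => x /= x0.
by rewrite lt_gtF.
Qed.

(** The remaining terms sum to [- x], hence contribute at least [`|x|]. *)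
Lemma sum_norm_zero_sum_lb (R : numDomainType) (s : seq R) (x : R) :
  \sum_(y <- s) y = 0 -> x \in s -> `|x| *+ 2 <= \sum_(y <- s) `|y|.
Proof.
move=> s0 sx; rewrite (perm_big _ (perm_to_rem sx)) big_cons mulr2n lerD2l.
move: s0; rewrite (perm_big _ (perm_to_rem sx)) big_cons => /eqP.
rewrite addr_eq0 => /eqP xE; rewrite {1}xE normrN; exact: ler_norm_sum.
Qed.

(** * Spectra of complex matrices *)

Lemma mem_spectrum n (A : 'M[algC]_n) x : (x \in spectrum A) = eigenvalue A x.
Proof. by rewrite eigenvalue_root_char spectrumP root_prod_XsubC. Qed.

Lemma size_spectrum n (A : 'M[algC]_n) : size (spectrum A) = n.
Proof.
by have := size_char_poly A; rewrite spectrumP size_prod_XsubC => -[].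
Qed.

Lemma sum_spectrum n (A : 'M[algC]_n) : \sum_(z <- spectrum A) z = \tr A.
Proof.
case: n A => [|n] A.
  by rewrite (size0nil (size_spectrum A)) big_nil /mxtrace big_ord0.
apply: oppr_inj; rewrite -char_poly_trace // [in RHS]spectrumP.
by rewrite -coefPn_prod_XsubC size_spectrum.
Qed.

(** * The common neighbourhood matrix of an arbitrary graph *)

Section CommonNeighbourMatrix.

Variable Gr : sgraph.

Local Notation N := #|Gr|.

Definition adjmx : 'M[algC]_N :=
  \matrix_(i, j) (@sadj Gr (enum_val i) (enum_val j))%:R.

Definition degmx : 'rV[algC]_N :=
  \row_i #|[set w : Gr | sadj (enum_val i) w]|%:R.

Lemma degmx_ge0_le i : 0 <= degmx 0 i <= N.-1%:R.
Proof.
rewrite mxE ler0n ler_nat /= -(cardsT Gr).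
rewrite (cardsD1 (enum_val i : Gr) setT) inE /=.
apply/subset_leq_card/subsetP=> w; rewrite !inE andbT.
by apply: contraTneq => ->; rewrite sadj_irrefl.
Qed.

(** Entry [(i, j)] of [A *m A^T] counts the vertices adjacent to both ends;
    they automatically differ from both, as loops are excluded.  On the
    diagonal this count is the degree. *)
Lemma CN_adjmx : CN Gr = adjmx *m adjmx^T - diag_mx degmx.
Proof.
apply/matrixP=> i j; rewrite !mxE.
transitivity (#|[set w : Gr | sadj (enum_val i) w && sadj (enum_val j) w]|%:R
   - (#|[set w : Gr | sadj (enum_val i) w]|%:R *+ (i == j)) : algC); last first.
  congr (_ - _); rewrite -sum1_card natr_sum big_mkcond.
  rewrite (reindex _ (onW_bij _ (@enum_val_bij Gr))) /=; apply: eq_bigr => k _.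
  by rewrite !mxE inE; do 2!case: sadj; rewrite ?mulr1 ?mulr0.
have [<-|nij] := eqVneq i j.
  apply/esym/eqP; rewrite subr_eq0; apply/eqP; congr _%:R.
  by apply: eq_card => w; rewrite !inE andbb.
rewrite subr0; congr _%:R; apply: eq_card => w; rewrite !inE.
have adj_neq (u : Gr) : sadj u w -> w != u.
  by apply: contraTneq => ->; rewrite sadj_irrefl.
apply/idP/idP=> [/and4P[_ _ -> ->] // | /andP[iw jw]].
by rewrite iw jw !adj_neq.
Qed.

Lemma CN_ge0_le i j : 0 <= CN Gr i j <= N.-2%:R.
Proof.
rewrite mxE; have [|nij] := ifPn; first by rewrite lexx ler0n.
rewrite ler0n ler_nat -(cardsT Gr) (cardsD1 (enum_val i : Gr) setT) inE /=.
rewrite (cardsD1 (enum_val j : Gr) (_ :\ _)) !inE (inj_eq enum_val_inj).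
rewrite [j == i]eq_sym nij /=.
apply/subset_leq_card/subsetP=> w; rewrite !inE andbT.
by case/and4P=> -> ->.
Qed.

Lemma CN_sym i j : CN Gr i j = CN Gr j i.
Proof.
rewrite !mxE eq_sym; case: eqP => // _; congr _%:R; apply: eq_card => w.
by rewrite !inE andbCA; congr [&& _, _ & _]; rewrite andbC.
Qed.

Lemma CN_col_sum_le j : \sum_i CN Gr i j <= (N.-1 * N.-2)%:R.
Proof.
rewrite (bigD1 j) //= [X in X + _]mxE eqxx add0r.
apply: (@le_trans _ _ (\sum_(i | i != j) N.-2%:R)).
  by apply: ler_sum => i _; case/andP: (CN_ge0_le i j).
by rewrite sumr_const cardC1 card_ord -mulrnA mulnC.
Qed.

(** For an eigenvector [v] with conjugate transpose [v^*], the number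
    [x * `|v|^2 = v (CN Gr) v^*] equals
    [`|v A|^2 - \sum_j deg j * `|v_j|^2], which is real and at least
    [- (N - 1) * `|v|^2].  This also shows that [x] is real, the order on
    [algC] only comparing numbers with a real difference. *)
Lemma CN_eigenvalue_ge x : eigenvalue (CN Gr) x -> - N.-1%:R <= x.
Proof.
case/eigenvalueP=> v vx v0.
set q := \sum_j `|v 0 j| ^+ 2.
have q0 : 0 < q.
  rewrite lt_def sumr_ge0 ?andbT; last by move=> j _; rewrite exprn_ge0.
  apply: contraNneq v0 => /psumr_eq0P q0; apply/eqP/rowP=> j; rewrite mxE.
  have /eqP := q0 (fun j _ => exprn_ge0 2 (normr_ge0 (v 0 j))) j isT.
  by rewrite expf_eq0 /= normr_eq0 => /eqP.
(* Both sides are v (CN Gr) v^*. *)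
have Exq : x * q = \sum_k `|(v *m adjmx) 0 k| ^+ 2
                   - \sum_j degmx 0 j * `|v 0 j| ^+ 2.
  have: (v *m CN Gr *m (map_mx Num.conj v)^T) 0 0 = x * q.
    rewrite vx -scalemxAl mxE; congr (_ * _); rewrite mxE.
    by apply: eq_bigr => j _; rewrite !mxE normCK.
  move<-; rewrite CN_adjmx mulmxBr mulmxBl [LHS]mxE; congr (_ + _).
    rewrite mulmxA -mulmxA -trmx_mul mxE; apply: eq_bigr => k _.
    rewrite normCK; congr (_ * _); rewrite !mxE rmorph_sum.
    apply: eq_bigr => j _; rewrite !mxE rmorphM /=; congr (_ * _).
    by rewrite conjC_nat.
  rewrite mxE; congr (- _); rewrite mul_mx_diag mxE; apply: eq_bigr => j _.
  by rewrite !mxE normCK mulrAC mulrC.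
rewrite -(ler_pM2r q0) Exq mulNr lerBrDr.
apply: (@le_trans _ _ 0); last by apply: sumr_ge0 => k _; rewrite exprn_ge0.
rewrite addrC subr_le0 mulr_sumr; apply: ler_sum => j _.
by rewrite ler_wpM2r ?exprn_ge0 //; case/andP: (degmx_ge0_le j).
Qed.

(** Compare the l1-norms of both sides of [v *m CN Gr = x *: v]: the entries
    are nonnegative, so the norm grows at most by the largest row sum. *)
Lemma CN_eigenvalue_norm_le x :
  eigenvalue (CN Gr) x -> `|x| <= (N.-1 * N.-2)%:R.
Proof.
case/eigenvalueP=> v vx v0.
set q := \sum_j `|v 0 j|.
have q0 : 0 < q.
  rewrite lt_def sumr_ge0 ?andbT //.
  apply: contraNneq v0 => /psumr_eq0P q0; apply/eqP/rowP=> j; rewrite mxE.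
  by apply/eqP; rewrite -normr_eq0 q0.
rewrite -(ler_pM2r q0) mulr_sumr.
have /le_trans->// :
    \sum_j `|x| * `|v 0 j| <= \sum_j \sum_i `|v 0 i| * CN Gr i j.
  apply: ler_sum => j _; rewrite -normrM.
  have -> : x * v 0 j = (v *m CN Gr) 0 j by rewrite vx mxE.
  rewrite mxE (le_trans (ler_norm_sum _ _ _)) //; apply: ler_sum => i _.
  by rewrite normrM (ger0_norm (x := CN _ _ _)) //; case/andP: (CN_ge0_le i j).
rewrite exchange_big mulr_sumr; apply: ler_sum => i _.
rewrite -mulr_sumr mulrC ler_wpM2r //.
under eq_bigr do rewrite CN_sym.
exact: CN_col_sum_le.
Qed.

Lemma sum_spectrum_CN : \sum_(z <- spectrum (CN Gr)) z = 0.
Proof. by rewrite sum_spectrum /mxtrace big1 // => i _; rewrite mxE eqxx. Qed.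

Lemma CN_energy_le : CN_energy Gr <= (N.-1 * N.-2)%:R *+ 2.
Proof.
apply: sum_norm_zero_sum_ub; first exact: sum_spectrum_CN.
  by rewrite size_spectrum; case: N => [|[]].
move=> x; rewrite mem_spectrum => ev_x; have xge := CN_eigenvalue_ge ev_x.
rewrite xge (le_trans _ (CN_eigenvalue_norm_le ev_x)) // real_ler_norm //.
by rewrite -(ler_real xge) realN realn.
Qed.

End CommonNeighbourMatrix.

(** * Comparison with the complete graph *)

Lemma CN_complete_graph n :
  CN (complete_graph n) = \matrix_(i, j) (n.-2%:R *+ (i != j)).
Proof.
apply/matrixP=> i j; rewrite !mxE; have [|nij] := eqVneq i j => //.
rewrite mulr1n; congr _%:R.
rewrite -[n in RHS]card_ord -(cardsT 'I_n) (cardsD1 (enum_val i) setT) inE /=.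
rewrite (cardsD1 (enum_val j) (_ :\ _)) !inE (inj_eq enum_val_inj).
rewrite [j == i]eq_sym nij /=.
apply: eq_card => w; rewrite !inE andbT /= ![_ == w]eq_sym.
by do 2!case: (w == _).
Qed.

(** The truncated predecessors make the left-hand side [0] when [n <= 2]. *)
Lemma CN_energy_complete_ge n :
  (n.-1 * n.-2)%:R *+ 2 <= CN_energy (complete_graph n).
Proof.
case: n => [|n]; first by rewrite mul0rn sumr_ge0.
set K := complete_graph n.+1.
rewrite -[X in X *+ 2]ger0_norm ?ler0n //.
apply: sum_norm_zero_sum_lb; first exact: sum_spectrum_CN.
have cardK : #|K| = n.+1 by rewrite card_ord.
rewrite mem_spectrum; apply/eigenvalueP; exists (const_mx 1); last first.
  have i0 : 'I_#|K| by rewrite cardK; exact: ord0.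
  by apply/eqP=> /rowP/(_ i0)/eqP; rewrite !mxE oner_eq0.
apply/rowP=> j; rewrite CN_complete_graph !mxE mulr1.
under eq_bigr do rewrite !mxE mul1r mulrb.
rewrite -big_mkcond /= sumr_const cardC1 card_ord cardK /=.
by rewrite -mulrnA mulnC.
Qed.

Lemma not_CN_hyperenergetic (Gr : sgraph) : ~ CN_hyperenergetic Gr.
Proof.
have /le_gtF := le_trans (CN_energy_le Gr) (CN_energy_complete_ge #|Gr|).
by rewrite /CN_hyperenergetic => ->.
Qed.

Lemma CN_energy_card_le2 (Gr : sgraph) : (#|Gr| <= 2)%N -> CN_energy Gr = 0.
Proof.
move=> N2; apply: le_anti; rewrite sumr_ge0 // andbT.
rewrite (le_trans (CN_energy_le Gr)) //.
by move: N2; case: #|Gr| => [|[|[]]] //= _; rewrite ?muln0 mul0rn.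
Qed.

Lemma CN_borderenergetic_card_le2 (Gr : sgraph) :
  (#|Gr| <= 2)%N -> CN_borderenergetic Gr.
Proof.
by move=> N2; rewrite /CN_borderenergetic !CN_energy_card_le2 ?card_ord.
Qed.

(** * Counting non-central conjugacy classes *)

(** Non-central classes are pairwise disjoint, have at least two elements each,
    and avoid the identity. *)
Lemma card_noncentral_classes (gT : finGroupType) (G : {group gT}) :
  (#|noncentral_classes G| * 2 < #|G|)%N.
Proof.
set P := noncentral_classes G.
have sPG : P \subset classes G.
  by apply/subsetP=> _ /imsetP[x /setDP[Gx _] ->]; apply: imset_f.
have tiP : trivIset P.
  by apply: trivIsetS sPG _; case/and3P: (classes_partition G).
rewrite (cardsD1 1%g G) group1 ltnS.
apply: (@leq_trans #|cover P|); last first.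
  apply/subset_leq_card/bigcupsP=> _ /imsetP[x /setDP[Gx nZx] ->].
  rewrite subsetD1 class_subG //=.
  apply: contra nZx => /imsetP[y Gy /esym/eqP].
  by rewrite conjg_eq1 => /eqP->; exact: group1.
rewrite -(eqP tiP) -sum_nat_const.
apply: leq_sum => _ /imsetP[x /setDP[Gx nZx] ->].
rewrite ltnNge; apply: contra nZx => le1.
apply/centerP; split=> // y Gy; apply/commgP/conjg_fixP.
apply/set1P; have/eqP <- : (x ^: G)%g == [set x].
  by rewrite eq_sym eqEcard sub1set class_refl cards1.
exact: memJ_class.
Qed.

Theorem theorem3p6 (gT : finGroupType) (G : {group gT}) :
  (forall n : nat, (1 < n)%N ->
     (G / 'Z(G) \isog 'D_(2 * n))%g -> ~ CN_hyperenergetic (ccc_graph G)) /\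
  ((G \isog 'D_6)%g -> CN_borderenergetic (ccc_graph G)).
Proof.
split=> [n _ _ | /card_isog cardG]; first exact: not_CN_hyperenergetic.
apply: CN_borderenergetic_card_le2; rewrite card_sig.
have := card_noncentral_classes G.
rewrite cardG (@card_dihedral 3) // => lt6.
by rewrite -ltnS -(@ltn_pmul2r 2).
Qed.
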